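(* Fix any $\lambda>0$, $\rho>0$ and $\tau>0$. For any $z\in\mathbb{R}^n$, letting $P$ be an $n\times n$ signed permutation matrix with $Pz=|z|^{\downarrow}$, it holds that $$\mathcal{P}_{\tau}h_{\lambda,\rho}(z)=P^{\mathbb{T}}\,\Pi_{\mathcal{S}_{+}}\big(|z|^{\downarrow}-\tau\lambda\rho e\big).$$
   Context: $\mathcal{S}=\{x\in\mathbb{R}^n:\|x\|=1\}$ is the Euclidean unit sphere, $\delta_{\mathcal{S}}$ its indicator function, $\mathcal{S}_{+}:=\mathcal{S}\cap\mathbb{R}^n_{+}$, and $e$ is the all-ones vector. $h_{\lambda,\rho}(x):=\delta_{\mathcal{S}}(x)+\lambda\rho\|x\|_1$. The (set-valued) proximal mapping of $h$ with parameter $\tau>0$ is $\mathcal{P}_{\tau}h(x):=\arg\min_{z\in\mathbb{R}^n}\{\frac{1}{2\tau}\|z-x\|^2+h(z)\}$, and $\Pi_{C}$ is the (set-valued) Euclidean projection onto the closed set $C$. $|z|$ is the entrywise absolute value of $z$, and $z^{\downarrow}$ is the vector of entries of $z$ arranged in nonincreasing order. A matrix times a set is the set of images.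
   Formalization: The formal statement assumes z ≠ 0; at z = 0 the claimed equality fails for every n ≥ 1, since the proximal set is all ±e_i while the right-hand side contains only one vector of each pair {e_j, −e_j}. *)

(* Defs.v *)
From HB Require Import structures.
From mathcomp Require Import all_boot all_order all_fingroup all_algebra.
From mathcomp Require Import boolp classical_sets reals ereal.

Set Implicit Arguments.
Unset Strict Implicit.
Unset Printing Implicit Defensive.

Import Order.TTheory GRing.Theory Num.Theory.

Local Open Scope classical_set_scope.
Local Open Scope ring_scope.

(* The norm `|x| that the library puts on matrices is the max norm, hence the
   explicit Euclidean and l1 norms. *)
Definition l2norm (R : realType) (n : nat) (x : 'cV[R]_n) : R :=
  Num.sqrt (\sum_(i < n) x i 0 ^+ 2).

Definition l1norm (R : realType) (n : nat) (x : 'cV[R]_n) : R :=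
  \sum_(i < n) `|x i 0|.

Definition indicator (R : realType) (T : Type) (C : set T) (x : T) : \bar R :=
  if `[< C x >] then 0%E else +oo%E.

(* An infinite value is never a minimum: argmin f is empty when f is
   identically +oo. *)
Definition argmin (R : realType) (T : Type) (f : T -> \bar R) : set T :=
  [set x | (f x < +oo)%E /\ forall y, (f x <= f y)%E].

Definition prox (R : realType) (n : nat) (tau : R) (h : 'cV[R]_n -> \bar R)
    (x : 'cV[R]_n) : set 'cV[R]_n :=
  argmin (fun z => ((2 * tau)^-1 * l2norm (z - x) ^+ 2)%:E + h z)%E.

Definition proj_set (R : realType) (n : nat) (C : set 'cV[R]_n)
    (x : 'cV[R]_n) : set 'cV[R]_n :=
  [set y | C y /\ forall w, C w -> l2norm (y - x) <= l2norm (w - x)].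

Definition sphere (R : realType) (n : nat) : set 'cV[R]_n :=
  [set x | l2norm x = 1].

Definition sphere_plus (R : realType) (n : nat) : set 'cV[R]_n :=
  @sphere R n `&` [set x | forall i, 0 <= x i 0].

Definition h_fun (R : realType) (n : nat) (lambda rho : R)
    (x : 'cV[R]_n) : \bar R :=
  (indicator R (@sphere R n) x + (lambda * rho * l1norm x)%:E)%E.

Definition abs_vec (R : realType) (n : nat) (x : 'cV[R]_n) : 'cV[R]_n :=
  \col_i `|x i 0|.

Definition sort_desc (R : realType) (n : nat) (x : 'cV[R]_n) : 'cV[R]_n :=
  \col_(i < n) (sort >=%R [seq x j 0 | j <- enum 'I_n])`_i.

Definition signed_perm_mx (R : realType) (n : nat) (P : 'M[R]_n) : Prop :=
  exists (s : 'S_n) (b : 'I_n -> bool),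
    P = diag_mx (\row_i (-1) ^+ b i) *m perm_mx s.

(* Main.v *)
Require Import Defs.
From HB Require Import structures.
From mathcomp Require Import all_boot all_order all_fingroup all_algebra.
From mathcomp Require Import boolp classical_sets reals ereal.
From mathcomp Require Import ring lra.

Import Order.TTheory GRing.Theory Num.Theory.

Local Open Scope classical_set_scope.
Local Open Scope ring_scope.

(** On the unit sphere the quadratic term of the proximal objective is affine:
    ||w - x||^2 = 1 + ||x||^2 - 2 <w, x>.  With c = tau * lambda * rho, the
    proximal points of z are therefore the maximisers over the sphere of the
    score <w, z> - c ||w||_1 ([proxP]).  In the same way, the projections of
    x - c e onto the nonnegative part of the sphere are the maximisers there
    of <w, x - c e>, which is again the score of w against x
    ([proj_sphere_plusP]).

    A signed permutation P preserves the Euclidean norm and satisfies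
    score (P z) (P w) = score z w, so everything reduces to x = P z = |z|^down,
    a nonzero vector with nonnegative entries, and to comparing the maximisers
    of its score over the sphere with those over the nonnegative part.

    - A maximiser over the nonnegative part is a maximiser over the sphere,
      since replacing w by |w| does not decrease the score ([score_abs_vec]).
    - A maximiser u over the sphere is nonnegative ([score_argmax_ge0]).
      Suppose u_i < 0.  If x_i > 0, changing the sign of u_i increases the
      score.  If x_i = 0, choose j with x_j > 0 and move the mass of coordinate
      i to coordinate j, replacing (u_i, u_j) by (0, r) with
      r = sqrt (u_i^2 + u_j^2): as |u_j| < r <= |u_i| + |u_j|, the correlation
      with x strictly increases and the l1 norm does not.  This second case is
      where x != 0 matters. *)

(** * The score and the two variational problems *)

(** Summed coordinate by coordinate, so that changing one or two entries of
    [w] changes only the corresponding summands. *)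
Definition score {R : realType} {n : nat} (c : R) (x w : 'cV[R]_n) : R :=
  \sum_(i < n) (w i 0 * x i 0 - c * `|w i 0|).

Lemma l2norm_sqr {R : realType} {n : nat} (x : 'cV[R]_n) :
  l2norm x ^+ 2 = \sum_(i < n) x i 0 ^+ 2.
Proof. by rewrite sqr_sqrtr // sumr_ge0 // => i _; exact: sqr_ge0. Qed.

Lemma l2norm_ge0 {R : realType} {n : nat} (x : 'cV[R]_n) : 0 <= l2norm x.
Proof. exact: sqrtr_ge0. Qed.

Lemma sphereE {R : realType} {n : nat} (w : 'cV[R]_n) :
  sphere w <-> \sum_(i < n) w i 0 ^+ 2 = 1.
Proof.
rewrite /sphere /= -l2norm_sqr; split=> [->|/eqP]; first by rewrite expr1n.
by rewrite sqrp_eq1 ?l2norm_ge0 // => /eqP.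
Qed.

Lemma scoreE {R : realType} {n : nat} (c : R) (x w : 'cV[R]_n) :
  score c x w = \sum_(i < n) w i 0 * x i 0 - c * l1norm w.
Proof. by rewrite /score sumrB /l1norm mulr_sumr. Qed.

Lemma sphere_l2dist {R : realType} {n : nat} (w x : 'cV[R]_n) : sphere w ->
  l2norm (w - x) ^+ 2 =
  1 + l2norm x ^+ 2 - 2 * \sum_(i < n) w i 0 * x i 0.
Proof.
move=> /sphereE w1; rewrite !l2norm_sqr -{1}w1 mulr_sumr -sumrN -!big_split /=.
by apply: eq_bigr => i _; rewrite !mxE; ring.
Qed.

Lemma prox_objectiveE {R : realType} {n : nat} (lambda rho tau : R)
    (tau_gt0 : 0 < tau) (x w : 'cV[R]_n) : sphere w ->
  (2 * tau)^-1 * l2norm (w - x) ^+ 2 + lambda * rho * l1norm w =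
  (2 * tau)^-1 * (1 + l2norm x ^+ 2)
    - tau^-1 * score (tau * lambda * rho) x w.
Proof.
by move=> w1; rewrite sphere_l2dist // scoreE; field; rewrite gt_eqF.
Qed.

(** Off the sphere the objective is +oo, so such points are neither minimisers
    nor competitors; on the sphere it is a decreasing affine function of the
    score. *)
Lemma proxP {R : realType} {n : nat} (lambda rho tau : R)
    (tau_gt0 : 0 < tau) (x w : 'cV[R]_n) :
  prox tau (h_fun lambda rho) x w <->
  sphere w /\ forall v, sphere v ->
    score (tau * lambda * rho) x v <= score (tau * lambda * rho) x w.
Proof.
pose f v := ((2 * tau)^-1 * l2norm (v - x) ^+ 2 + lambda * rho * l1norm v)%R.
pose g v := (((2 * tau)^-1 * l2norm (v - x) ^+ 2)%:E + h_fun lambda rho v)%E.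
have gS v : sphere v -> g v = (f v)%:E.
  by move=> v1; rewrite /g /h_fun /indicator asboolT // add0e -EFinD.
have gN v : ~ sphere v -> g v = +oo%E.
  by move=> v1; rewrite /g /h_fun /indicator asboolF.
have le_f u v : sphere u -> sphere v ->
    (f u <= f v) = (score (tau * lambda * rho) x v
                     <= score (tau * lambda * rho) x u).
  move=> u1 v1; rewrite /f !prox_objectiveE // lerD2l lerN2.
  by rewrite ler_pM2l // invr_gt0.
change ((g w < +oo)%E /\ (forall v, g w <= g v)%E <->
  sphere w /\ forall v, sphere v ->
    score (tau * lambda * rho) x v <= score (tau * lambda * rho) x w).
split=> [[gw_lt wmin]|[w1 wmax]].
  have w1 : sphere w by apply: contrapT => /gN gw; rewrite gw ltxx in gw_lt.
  by split=> // v v1; rewrite -le_f // -lee_fin -!gS.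
split=> [|v]; first by rewrite gS // ltry.
have [v1|v1] := pselect (sphere v); last by rewrite (gN v) // leey.
by rewrite !gS // lee_fin le_f // wmax.
Qed.

Lemma score_ge0E {R : realType} {n : nat} (c : R) (x w : 'cV[R]_n) :
  (forall i, 0 <= w i 0) ->
  \sum_(i < n) w i 0 * (x - c *: const_mx 1) i 0 = score c x w.
Proof.
by move=> w0; apply: eq_bigr => i _; rewrite !mxE ger0_norm //; ring.
Qed.

(** On nonnegative vectors the l1 norm is the inner product with e, which is
    how shifting the projected point by c e produces the l1 penalty. *)
Lemma proj_sphere_plusP {R : realType} {n : nat} (c : R) (x w : 'cV[R]_n) :
  proj_set (@sphere_plus R n) (x - c *: const_mx 1) w <->
  sphere_plus w /\ forall v, sphere_plus v -> score c x v <= score c x w.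
Proof.
have le_dist u v : sphere_plus u -> sphere_plus v ->
    (l2norm (u - (x - c *: const_mx 1)) <= l2norm (v - (x - c *: const_mx 1)))
    = (score c x v <= score c x u).
  move=> [u1 u0] [v1 v0].
  rewrite -[LHS](ler_pXn2r (n := 2)) ?nnegrE ?l2norm_ge0 //.
  rewrite (sphere_l2dist _ _ u1) (sphere_l2dist _ _ v1) !score_ge0E //.
  by rewrite lerD2l lerN2 ler_pM2l.
by split=> -[wS wopt]; split=> // v vS; move: (wopt v vS); rewrite le_dist.
Qed.

(** * Maximisers of the score against a nonnegative vector *)

Lemma sphere_abs_vec {R : realType} {n : nat} (w : 'cV[R]_n) :
  sphere w -> sphere_plus (abs_vec w).
Proof.
move=> /sphereE w1; split=> [|i /=]; last by rewrite mxE.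
apply/sphereE; rewrite -w1; apply: eq_bigr => i _.
by rewrite mxE real_normK ?num_real.
Qed.

Lemma score_abs_vec {R : realType} {n : nat} (c : R) (x w : 'cV[R]_n) :
  (forall i, 0 <= x i 0) -> score c x w <= score c x (abs_vec w).
Proof.
move=> x0; apply: ler_sum => i _; rewrite mxE normr_id lerD2r.
by rewrite ler_wpM2r // ler_norm.
Qed.

Lemma sum_D2 {R : realType} {n : nat} {i j : 'I_n} (F : 'I_n -> R) : j != i ->
  \sum_(k < n) F k = F i + F j + \sum_(k < n | (k != i) && (k != j)) F k.
Proof. by move=> ji; rewrite (bigD1 i) //= (bigD1 j) //= addrA. Qed.

Lemma score_flip {R : realType} {n : nat} (c : R) (x u : 'cV[R]_n)
    (i : 'I_n) : sphere u -> u i 0 < 0 -> 0 < x i 0 ->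
  exists2 v, sphere v & score c x u < score c x v.
Proof.
move=> /sphereE u1 ui xi.
pose v := \col_k (if k == i then - u i 0 else u k 0) : 'cV[R]_n.
have vi : v i 0 = - u i 0 by rewrite mxE eqxx.
have vk k : k != i -> v k 0 = u k 0 by move=> /negPf ki; rewrite mxE ki.
exists v.
  apply/sphereE; rewrite -u1 [LHS](bigD1 i) // [RHS](bigD1 i) //= vi sqrrN.
  by congr (_ + _); apply: eq_bigr => k /vk ->.
rewrite /score (bigD1 i) //= [ltRHS](bigD1 i) //= vi normrN.
rewrite [X in _ < _ + X](eq_bigr (fun k => u k 0 * x k 0 - c * `|u k 0|)).
  by rewrite ltrD2r; nra.
by move=> k /vk ->.
Qed.

(** Moving the mass of coordinate [i] onto coordinate [j] costs no correlation
    at [i], because x_i = 0, and gains some at [j].  The l1 norm does not grow,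
    since sqrt (a^2 + b^2) <= |a| + |b|. *)
Lemma score_move {R : realType} {n : nat} (c : R) (x u : 'cV[R]_n)
    (i j : 'I_n) : 0 <= c -> sphere u -> u i 0 < 0 -> x i 0 = 0 -> 0 < x j 0 ->
  exists2 v, sphere v & score c x u < score c x v.
Proof.
move=> c0 /sphereE u1 ui xi xj.
have ji : j != i by apply: contraTneq xj => ->; rewrite xi ltxx.
pose r := Num.sqrt (u i 0 ^+ 2 + u j 0 ^+ 2).
have r0 : 0 <= r by exact: sqrtr_ge0.
have r2 : r ^+ 2 = u i 0 ^+ 2 + u j 0 ^+ 2.
  by rewrite sqr_sqrtr // addr_ge0 // sqr_ge0.
pose v := \col_k (if k == i then 0 else if k == j then r else u k 0)
  : 'cV[R]_n.
have vi : v i 0 = 0 by rewrite mxE eqxx.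
have vj : v j 0 = r by rewrite mxE (negPf ji) eqxx.
have vk k : (k != i) && (k != j) -> v k 0 = u k 0.
  by move=> /andP[/negPf ki /negPf kj]; rewrite mxE ki kj.
exists v.
  apply/sphereE; rewrite -u1 !(sum_D2 _ ji) vi vj r2 expr0n add0r.
  by congr (_ + _); apply: eq_bigr => k /vk ->.
have uj_lt_r : u j 0 < r by nra.
have r_le : r <= `|u i 0| + `|u j 0|.
  rewrite -(ler_pXn2r (n := 2)) ?nnegrE ?addr_ge0 // r2 sqrrD.
  rewrite !real_normK ?num_real //.
  by have := mulr_ge0 (normr_ge0 (u i 0)) (normr_ge0 (u j 0)); lra.
rewrite /score !(sum_D2 _ ji) vi vj xi normr0 (ger0_norm r0).
rewrite [X in _ < _ + X](eq_bigr (fun k => u k 0 * x k 0 - c * `|u k 0|)).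
  rewrite ltrD2r.
  have corr_lt : u j 0 * x j 0 < r * x j 0 by rewrite ltr_pM2r.
  have pen_le : c * r <= c * (`|u i 0| + `|u j 0|) by rewrite ler_wpM2l.
  by lra.
by move=> k /vk ->.
Qed.

Lemma score_argmax_ge0 {R : realType} {n : nat} (c : R) (x u : 'cV[R]_n) :
  0 <= c -> (forall i, 0 <= x i 0) -> x != 0 -> sphere u ->
  (forall v, sphere v -> score c x v <= score c x u) ->
  forall i, 0 <= u i 0.
Proof.
move=> c0 x0 xn0 u1 umax i; rewrite leNgt; apply/negP => ui.
suff [v v1] : exists2 v, sphere v & score c x u < score c x v.
  by rewrite ltNge umax.
have [j xj] : exists j, 0 < x j 0.
  apply: contrapT => x_npos; case/eqP: xn0; apply/matrixP => k l.
  rewrite (ord1 l) mxE; apply/eqP; rewrite eq_le x0 andbT leNgt.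
  by apply/negP => xk; apply: x_npos; exists k.
have [xi|xi] := eqVneq (x i 0) 0; first exact: (score_move c x u i j).
by apply: score_flip ui _ => //; rewrite lt_def xi x0.
Qed.

(** * Signed permutations *)

Lemma signed_permE {R : realType} {n : nat} (s : 'S_n) (b : 'I_n -> bool)
    (w : 'cV[R]_n) (i : 'I_n) :
  (diag_mx (\row_i (-1) ^+ b i) *m perm_mx s *m w) i 0
  = (-1) ^+ b i * w (s i) 0.
Proof. by rewrite -mulmxA -row_permE mul_diag_mx !mxE. Qed.

Lemma signed_perm_sphere {R : realType} {n : nat} (P : 'M[R]_n)
    (w : 'cV[R]_n) : signed_perm_mx P -> sphere (P *m w) <-> sphere w.
Proof.
move=> [s [b ->]]; rewrite !sphereE.
suff -> : \sum_i (diag_mx (\row_i (-1) ^+ b i) *m perm_mx s *m w) i 0 ^+ 2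
    = \sum_i w i 0 ^+ 2 by [].
rewrite [RHS](reindex_inj (@perm_inj _ s)); apply: eq_bigr => i _.
by rewrite signed_permE exprMn sqrr_sign mul1r.
Qed.

Lemma signed_perm_score {R : realType} {n : nat} (P : 'M[R]_n) (c : R)
    (z w : 'cV[R]_n) : signed_perm_mx P ->
  score c (P *m z) (P *m w) = score c z w.
Proof.
move=> [s [b ->]]; rewrite /score [RHS](reindex_inj (@perm_inj _ s)).
apply: eq_bigr => i _; rewrite !signed_permE normrM normr_sign mul1r.
by rewrite mulrACA -expr2 sqrr_sign mul1r.
Qed.

Lemma signed_perm_orthogonal {R : realType} {n : nat} (P : 'M[R]_n) :
  signed_perm_mx P -> P^T *m P = 1%:M.
Proof.
move=> [s [b ->]]; rewrite trmx_mul tr_diag_mx tr_perm_mx mulmxA.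
rewrite -[_ *m diag_mx _ *m diag_mx _]mulmxA mulmx_diag.
have -> : diag_mx (\row_j ((\row_i (-1) ^+ b i) 0 j * (\row_i (-1) ^+ b i) 0 j))
    = 1%:M :> 'M[R]_n.
  by apply/matrixP => i j; rewrite !mxE -expr2 sqrr_sign.
by rewrite mulmx1 -perm_mxM mulVg perm_mx1.
Qed.

Lemma sort_desc_abs_ge0 {R : realType} {n : nat} (z : 'cV[R]_n) (i : 'I_n) :
  0 <= sort_desc (abs_vec z) i 0.
Proof.
rewrite mxE; set s := sort _ _.
have /(mem_nth 0) : (i < size s)%N by rewrite size_sort size_map size_enum_ord.
by rewrite mem_sort => /mapP[j _ ->]; rewrite mxE.
Qed.

(** * The proximal mapping as a projection *)

(** Both sides are sets of maximisers of the same score: passing to absolute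
    values gives one inclusion, the nonnegativity of the maximisers over the
    whole sphere gives the other. *)
Lemma prox_nonneg {R : realType} {n : nat} (lambda rho tau : R)
    (lambda_gt0 : 0 < lambda) (rho_gt0 : 0 < rho) (tau_gt0 : 0 < tau)
    (x : 'cV[R]_n) (x_ge0 : forall i, 0 <= x i 0) (x_neq0 : x != 0) :
  prox tau (h_fun lambda rho) x =
  proj_set (@sphere_plus R n) (x - (tau * lambda * rho) *: const_mx 1).
Proof.
have c0 : 0 <= tau * lambda * rho by rewrite !mulr_ge0 // ltW.
apply/seteqP; split=> u.
  move=> /proxP -/(_ tau_gt0)[u1 umax]; apply/proj_sphere_plusP.
  split=> [|v [v1 _]]; last exact: umax.
  by split=> //; exact: score_argmax_ge0 umax.
move=> /proj_sphere_plusP[[u1 _] umax]; apply/proxP => //; split=> // v v1.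
by rewrite (le_trans (score_abs_vec _ _ _ _)) // umax //; exact: sphere_abs_vec.
Qed.

(** The sphere and the score are invariant under P, which is a bijection of
    the sphere onto itself. *)
Lemma prox_signed_perm {R : realType} {n : nat} (lambda rho tau : R)
    (tau_gt0 : 0 < tau) (P : 'M[R]_n) (P_sp : signed_perm_mx P)
    (z w : 'cV[R]_n) :
  prox tau (h_fun lambda rho) (P *m z) (P *m w) <->
  prox tau (h_fun lambda rho) z w.
Proof.
have PPt : P *m P^T = 1%:M by apply: mulmx1C; exact: signed_perm_orthogonal.
rewrite !proxP // signed_perm_sphere //; split=> -[w1 wmax]; split=> // v v1.
  rewrite -(signed_perm_score P) // -(signed_perm_score P _ z w) //.
  by apply: wmax; rewrite signed_perm_sphere.
have vE : v = P *m (P^T *m v) by rewrite mulmxA PPt mul1mx.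
rewrite vE !signed_perm_score // wmax //.
by rewrite -(signed_perm_sphere P) // -vE.
Qed.

(* The equality fails at z = 0 for n >= 1, hence z_neq0: there the left-hand
   side contains every standard basis vector and its opposite, the right-hand
   side only one vector of each such pair. *)
Theorem proposition2p2 (R : realType) (n : nat) (lambda rho tau : R)
    (lambda_gt0 : 0 < lambda) (rho_gt0 : 0 < rho) (tau_gt0 : 0 < tau)
    (z : 'cV[R]_n) (z_neq0 : z != 0)
    (P : 'M[R]_n) (P_sp : signed_perm_mx P)
    (P_sort : P *m z = sort_desc (abs_vec z)) :
  prox tau (h_fun lambda rho) z =
  [set P^T *m y | y in proj_set (@sphere_plus R n)
     (sort_desc (abs_vec z) - (tau * lambda * rho) *: const_mx 1)].
Proof.
have PtP := signed_perm_orthogonal P P_sp.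
have PPt := mulmx1C PtP.
have x_neq0 : sort_desc (abs_vec z) != 0.
  rewrite -P_sort; apply: contra_neq z_neq0 => Pz0.
  by rewrite -[z]mul1mx -PtP -mulmxA Pz0 mulmx0.
rewrite -prox_nonneg // => [|i]; last exact: sort_desc_abs_ge0.
rewrite -P_sort; apply/seteqP; split=> [w wz|w [y yz <-]].
  exists (P *m w); first exact/prox_signed_perm.
  by rewrite mulmxA PtP mul1mx.
by apply/(prox_signed_perm _ _ _ tau_gt0 P P_sp); rewrite mulmxA PPt mul1mx.
Qed.
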